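(* Let $p(x_1,\ldots,x_d)$ be a polynomial of degree at most $N_j-1$ in the variable $x_j$ for $1\le j\le d$, and let $\mathcal{X}\in\mathbb{C}^{n_1\times\cdots\times n_d}$ be the tensor constructed by sampling $p$, i.e., $$\mathcal{X}_{i_1,\dots,i_d}=p(x^{(1)}_{i_1},\dots,x^{(d)}_{i_d}),\qquad 1\le i_j\le n_j,\quad 1\le j\le d,$$ where $x^{(1)},\dots,x^{(d)}$ are sets of $n_1,\dots,n_d$ nodes, respectively. Then: (i) $p^{\rm TT}(\mathcal{X})\le\sum_{k=1}^d t_{k-1}t_kn_k$, where $t_k=\min\{\prod_{j=1}^kN_j,\prod_{j=k+1}^dN_j\}$ for $0\le k\le d$ (empty products equal $1$); (ii) $p^{\rm ML}(\mathcal{X})\le\sum_{k=1}^dn_kN_k+\prod_{k=1}^dN_k$; and (iii) $p^{\rm CP}(\mathcal{X})\le r+r\sum_{k=1}^dn_k$, where $r=\min_{1\le k\le d}\frac{1}{N_k}\prod_{j=1}^dN_j$. Here the tensor-train decomposition is constructed in the order of $x_1,\dots,x_d$.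
   Context: $p^{\rm TT}(\mathcal{X})$, $p^{\rm ML}(\mathcal{X})$, $p^{\rm CP}(\mathcal{X})$ denote the smallest numbers of degrees of freedom needed to store $\mathcal{X}$ exactly in, respectively, tensor-train, orthogonal Tucker, and canonical polyadic (CP) format, defined as follows. Tensor-train: $\mathcal{X}$ has tensor-train rank at most $(s_0,\ldots,s_d)$, $s_0=s_d=1$, if there are $H_k:\{1,\ldots,n_k\}\to\mathbb{C}^{s_{k-1}\times s_k}$, $1\le k\le d$, with $\mathcal{X}_{i_1,\ldots,i_d}=H_1(i_1)\cdots H_d(i_d)$ for all indices (the order of factors being the order of the dimensions $1,\dots,d$); storage is $\sum_{k=1}^d s_{k-1}s_kn_k$. Orthogonal Tucker: $\mathcal{X}$ has multilinear rank at most $(t_1,\ldots,t_d)$ if $\mathcal{X}=\sum_{i_1=1}^{t_1}\cdots\sum_{i_d=1}^{t_d}\mathcal{C}_{i_1,\ldots,i_d}B^{(1)}_{i_1}\circ\cdots\circ B^{(d)}_{i_d}$ for a core tensor $\mathcal{C}\in\mathbb{C}^{t_1\times\cdots\times t_d}$ and matrices $B^{(k)}\in\mathbb{C}^{n_k\times t_k}$ with orthonormal columns $B^{(k)}_i$, where $\circ$ is the outer product; storage is $\sum_{k=1}^d n_kt_k+\prod_{k=1}^d t_k$. CP: $\mathcal{X}$ has rank at most $r$ if $\mathcal{X}=\sum_{i=1}^r D_i\,B^{(1)}_i\circ\cdots\circ B^{(d)}_i$ with scalars $D_i\in\mathbb{C}$ and vectors $B^{(k)}_i\in\mathbb{C}^{n_k}$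 (a sum of $r$ rank-1 tensors); storage is $r+r\sum_{k=1}^dn_k$. *)

(* Defs.v *)
From HB Require Import structures.
From mathcomp Require Import all_boot all_order all_algebra.
From mathcomp Require Import sesquilinear spectral.
From mathcomp Require Import boolp reals complex.
From mathcomp Require Import mpoly.

Set Implicit Arguments.
Unset Strict Implicit.
Unset Printing Implicit Defensive.

Import Order.TTheory GRing.Theory Num.Theory.

Local Open Scope ring_scope.
Local Open Scope sesquilinear_scope.

(* All indices are zero-based: the dimension written x_k with 1 <= k <= d on
   paper is indexed by k - 1 : 'I_d. *)

Definition midx (d : nat) (n : 'I_d -> nat) : finType :=
  {dffun forall k : 'I_d, 'I_(n k)}.

Definition tensor (K : Type) (d : nat) (n : 'I_d -> nat) : Type :=
  {ffun midx n -> K}.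

Definition outer (K : comNzRingType) (d : nat) (n : 'I_d -> nat)
    (v : forall k : 'I_d, 'cV[K]_(n k)) : tensor K n :=
  [ffun i : midx n => \prod_(k < d) v k (i k) ord0].

Definition degvar (K : nzRingType) (d : nat) (p : {mpoly K[d]}) (j : 'I_d) : nat :=
  (\max_(m <- msupp p) m j)%N.

Definition sample (K : comNzRingType) (d : nat) (n : 'I_d -> nat)
    (p : {mpoly K[d]}) (x : forall j : 'I_d, 'I_(n j) -> K) : tensor K n :=
  [ffun i : midx n => p.@[fun j => x j (i j)]].

Section Formats.
Variables (K : numClosedFieldType) (d : nat) (n : 'I_d -> nat).
Implicit Type X : tensor K n.

(* The rank sequence (s_0, ..., s_d) is a function on nat; only its values at
   0, ..., d matter. The factor H k has size s_k x s_(k+1), which is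
   s_(k-1) x s_k in one-based numbering. *)
Fixpoint tt_prod (s : nat -> nat)
    (H : forall k : 'I_d, 'I_(n k) -> 'M[K]_(s k, s k.+1)) (i : midx n) (m : nat) :
    (m <= d)%N -> 'M[K]_(s 0%N, s m) :=
  match m return (m <= d)%N -> 'M[K]_(s 0%N, s m) with
  | 0 => fun _ => 1%:M
  | m'.+1 => fun lt_m'd : (m' < d)%N =>
      tt_prod H i (ltnW lt_m'd) *m H (Ordinal lt_m'd) (i (Ordinal lt_m'd))
  end.

Definition tt_rank_le (s : nat -> nat) X : Prop :=
  exists (s0 : s 0%N = 1%N) (sd : s d = 1%N)
         (H : forall k : 'I_d, 'I_(n k) -> 'M[K]_(s k, s k.+1)),
    forall i : midx n, X i = castmx (s0, sd) (tt_prod H i (leqnn d)) ord0 ord0.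

Definition tt_storage (s : nat -> nat) : nat :=
  (\sum_(k < d) s k * s k.+1 * n k)%N.

Definition ml_rank_le (t : 'I_d -> nat) X : Prop :=
  exists (core : tensor K t) (B : forall k : 'I_d, 'M[K]_(n k, t k)),
    (forall k, (B k)^t* *m B k = 1%:M) /\
    forall i : midx n,
      X i = \sum_(j : midx t) core j * outer (fun k => col (j k) (B k)) i.

Definition ml_storage (t : 'I_d -> nat) : nat :=
  (\sum_(k < d) n k * t k + \prod_(k < d) t k)%N.

Definition cp_rank_le (r : nat) X : Prop :=
  exists (D : 'I_r -> K) (B : forall k : 'I_d, 'M[K]_(n k, r)),
    forall i : midx n, X i = \sum_(l < r) D l * outer (fun k => col l (B k)) i.

Definition cp_storage (r : nat) : nat := (r + r * \sum_(k < d) n k)%N.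

Definition tt_storable X (q : nat) : Prop :=
  exists s, tt_rank_le s X /\ tt_storage s = q.
Definition ml_storable X (q : nat) : Prop :=
  exists t, ml_rank_le t X /\ ml_storage t = q.
Definition cp_storable X (q : nat) : Prop :=
  exists r, cp_rank_le r X /\ cp_storage r = q.

(* Every tensor has an exact representation in each format, so that the smallest
   storage below is a genuine minimum. *)

Lemma midx_neq (i j : midx n) : j != i -> exists k, j k != i k.
Proof.
move=> neq_ji; apply/existsP; rewrite -negb_forall.
apply: contraNN neq_ji => /forallP eq_ji; apply/eqP/ffunP => k; exact/eqP.
Qed.

Lemma ml_storable_ex X : exists q, `[< ml_storable X q >].
Proof.
exists (ml_storage n); apply/asboolP; exists n; split=> //.
exists X, (fun k => 1%:M); split=> [k|i].
  by rewrite mulmx1 trmx1 map_scalar_mx rmorph1.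
rewrite (bigD1 i) //= [outer _ _]ffunE big1 => [|k _]; last by rewrite !mxE eqxx.
rewrite mulr1 big1 ?addr0 // => j neq_ji; rewrite [outer _ _]ffunE.
have [k neq_k] := midx_neq neq_ji.
by rewrite (bigD1 k) //= !mxE eq_sym (negPf neq_k) mul0r mulr0.
Qed.

Lemma sum_pinpoint X (i : midx n) :
  \sum_(l < #|midx n|) (\prod_(k < d) (enum_val l k == i k)%:R) * X (enum_val l)
    = X i.
Proof.
rewrite -(@big_enum_val _ _ _ _ (midx n) (fun j : midx n =>
  (\prod_(k < d) (j k == i k)%:R) * X j)).
rewrite (bigD1 i) //= big1 => [|k _]; last by rewrite eqxx.
rewrite mul1r big1 ?addr0 // => j neq_ji.
have [k neq_k] := midx_neq neq_ji.
by rewrite (bigD1 k) //= (negPf neq_k) !mul0r.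
Qed.

Lemma cp_storable_ex X : exists q, `[< cp_storable X q >].
Proof.
exists (cp_storage #|midx n|); apply/asboolP; exists #|midx n|; split=> //.
exists (fun l => X (enum_val l)).
exists (fun k => \matrix_(a, l) ((enum_val l : midx n) k == a)%:R) => i.
rewrite -sum_pinpoint; apply: eq_bigr => l _; rewrite [outer _ _]ffunE mulrC.
by congr (_ * _); apply: eq_bigr => k _; rewrite !mxE.
Qed.

Lemma tt_storable_ex (d_gt0 : (0 < d)%N) X : exists q, `[< tt_storable X q >].
Proof.
pose c := #|midx n|; pose s k := if (0 < k < d)%N then c else 1%N.
have s0 : s 0%N = 1%N by [].
have sd : s d = 1%N by rewrite /s ltnn andbF.
exists (tt_storage s); apply/asboolP; exists s; split=> //; exists s0, sd.
pose L k : 'M[K]_(s k, c) :=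
  \matrix_(u, v) (if k == 0%N then 1 else (u == v :> nat)%:R).
pose E k : 'M[K]_(c, s k) :=
  \matrix_(u, v) (if k == d then X (enum_val u) else (u == v :> nat)%:R).
pose D (k : 'I_d) (a : 'I_(n k)) : 'M[K]_c :=
  diag_mx (\row_l ((enum_val l : midx n) k == a)%:R).
pose H (k : 'I_d) (a : 'I_(n k)) : 'M[K]_(s k, s k.+1) := L k *m D k a *m E k.+1.
exists H => i.
have EL k : (0 < k < d)%N -> E k *m L k = 1%:M.
  move=> /[dup] k_in /andP[k_gt0 k_ltd].
  have sk : s k = c by rewrite /s k_in.
  rewrite /E /L (gtn_eqF k_gt0) (ltn_eqF k_ltd).
  move: (s k) sk => w ->; apply/matrixP => u v; rewrite !mxE (bigD1 u) //= !mxE.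
  rewrite eqxx mul1r big1 ?addr0 ?val_eqE // => j neq_ju.
  by rewrite !mxE val_eqE eq_sym (negPf neq_ju) mul0r.
have prodE m (le_md : (m.+1 <= d)%N) : tt_prod H i le_md =
    L 0%N *m diag_mx (\row_l (\prod_(k < d | (k <= m)%N)
      ((enum_val l : midx n) k == i k)%:R)) *m E m.+1.
  elim: m le_md => [|m IHm] le_md.
    rewrite /= mul1mx /H /D; congr (_ *m diag_mx _ *m _).
    apply/rowP => l; rewrite !mxE (bigD1 (Ordinal le_md)) //= big1 ?mulr1 //.
    by move=> k /andP[]; rewrite leqn0 -val_eqE /= => ->.
  rewrite [LHS]/= -/(tt_prod H i (ltnW le_md)) IHm /H !mulmxA.
  rewrite -[_ *m E m.+1 *m _]mulmxA EL // mulmx1.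
  rewrite -[_ *m D _ _]mulmxA /D mulmx_diag; congr (_ *m diag_mx _ *m _).
  apply/rowP => l; rewrite !mxE [RHS](bigD1 (Ordinal le_md)) //= mulrC.
  congr (_ * _); apply: eq_bigl => k.
  by rewrite -val_eqE /= andbC -ltn_neqAle.
have prod_d m (le_md : (m <= d)%N) : (0 < m)%N -> tt_prod H i le_md =
    L 0%N *m diag_mx (\row_l (\prod_(k < d | (k < m)%N)
      ((enum_val l : midx n) k == i k)%:R)) *m E m.
  by case: m le_md => // m le_md _; rewrite prodE.
rewrite castmxE prod_d // mul_mx_diag mxE -[LHS](sum_pinpoint X i).
apply: eq_bigr => l _; rewrite !mxE /= eqxx mul1r; congr (_ * _).
by apply: eq_bigl => k; rewrite ltn_ord.
Qed.

(* A tensor-train of order 0 only stores the value 1, whence d > 0. *)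
Definition p_TT (d_gt0 : (0 < d)%N) X : nat := ex_minn (tt_storable_ex d_gt0 X).
Definition p_ML X : nat := ex_minn (ml_storable_ex X).
Definition p_CP X : nat := ex_minn (cp_storable_ex X).

End Formats.

Definition tt_bound_rank (d : nat) (N : 'I_d -> nat) (k : nat) : nat :=
  (minn (\prod_(j < d | j < k) N j) (\prod_(j < d | k <= j) N j))%N.

(* The default value of the minimum is neutral when all N k are positive and
   0 < d; the division is then exact. *)
Definition cp_bound_rank (d : nat) (N : 'I_d -> nat) : nat :=
  (\big[minn/(\prod_(j < d) N j)]_(k < d) ((\prod_(j < d) N j) %/ N k))%N.

(* Main.v *)
(* Expanding p in monomials writes the samples as a Tucker format with factors
   A_k(a, b) = x^(k)_a ^ b and the coefficients of p as core.
   Tucker: a thin QR decomposition of each A_k orthonormalizes the factors.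
   CP: the terms agreeing off the variable x_k sum to a rank-one tensor.
   Tensor train: take the last k where the prefix product of the N_j does not
   exceed the suffix product. Bonds up to k carry the exponents of the preceding
   variables, later bonds those of the following ones, and the core at k
   switches from the former to the latter using the coefficients of p. *)

Require Import Defs.
From HB Require Import structures.
From mathcomp Require Import all_boot all_order all_algebra.
From mathcomp Require Import sesquilinear spectral.
From mathcomp Require Import boolp reals complex.
From mathcomp Require Import mpoly.

Set Implicit Arguments.
Unset Strict Implicit.
Unset Printing Implicit Defensive.

Import Order.TTheory GRing.Theory Num.Theory.

Local Open Scope ring_scope.
Local Open Scope sesquilinear_scope.

(** * Tucker formats and the monomial expansion of the samples *)

Definition tucker (K : comNzRingType) (d : nat) (n N : 'I_d -> nat)
    (c : tensor K N) (A : forall k, 'M[K]_(n k, N k)) : tensor K n :=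
  [ffun i : midx n => \sum_(m : midx N) c m * \prod_(k < d) A k (i k) (m k)].

Lemma prod_sum_midx (K : comNzRingType) (d : nat) (t : 'I_d -> nat)
    (F : forall k : 'I_d, 'I_(t k) -> K) :
  \prod_(k < d) \sum_(j < t k) F k j =
  \sum_(j : midx t) \prod_(k < d) F k (j k).
Proof.
rewrite (reindex _ (onW_bij _ (dffun_of_fprod_bij (fun k => 'I_(t k))))) /=.
pose Ff k := [ffun j : 'I_(t k) => F k j].
transitivity (\sum_(f : fprod (fun k => 'I_(t k))) \prod_k Ff k (f k));
  last first.
  by apply: eq_bigr => f _; apply: eq_bigr => k _; rewrite !ffunE.
rewrite big_fprod -(bigA_distr_big_dep _ (fun k => untag 0 (Ff k))).
apply: eq_bigr => k _.
by rewrite -(big_tag (fun k => Ff k)); apply: eq_bigr => j _; rewrite ffunE.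
Qed.

(** Gram-Schmidt on a basis of the column space of [A]. The width of [B] is the rank of [A], not
    [N]: there are no [N] orthonormal columns when [n < N]. *)
Lemma thin_qr (K : numClosedFieldType) (n N : nat) (A : 'M[K]_(n, N)) :
  exists t, (t <= N)%N /\ exists (B : 'M[K]_(n, t)) (Q : 'M[K]_(t, N)),
    B^t* *m B = 1%:M /\ A = B *m Q.
Proof.
exists (\rank A^T); split; first exact: rank_leq_row.
pose V := schmidt (row_base A^T).
have Vu : V \is unitarymx by rewrite schmidt_unitarymx ?rank_leq_col.
have /submxP[D AD] : (A^T <= V)%MS.
  by rewrite (eqmx_schmidt_free (row_base_free _)) eq_row_base.
exists V^T, D^T; split; last by rewrite -trmx_mul -AD trmxK.
have /unitarymxP/(congr1 (fun M => M^T)) := Vu.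
by rewrite trmx_mul trmx1 map_trmx.
Qed.

Lemma sample_tucker (K : comNzRingType) (d : nat) (N n : 'I_d -> nat)
    (p : {mpoly K[d]}) (x : forall j : 'I_d, 'I_(n j) -> K) :
    (forall j : 'I_d, (degvar p j < N j)%N) ->
  sample p x = tucker [ffun m : midx N => p@_[multinom m k : nat | k < d]]
    (fun k => \matrix_(a < n k, b < N k) x k a ^+ b).
Proof.
move=> p_deg; apply/ffunP => i; rewrite !ffunE mevalE.
pose h (m : midx N) : 'X_{1..d} := [multinom m k : nat | k < d].
have h_inj : injective h.
  move=> m m' /mnmP eq_h; apply/ffunP => k; apply/val_inj.
  by have := eq_h k; rewrite !mnmE.
transitivity (\sum_(m <- [seq h m | m : midx N])
    p@_m * \prod_(k < d) x k (i k) ^+ m k); last first.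
  rewrite big_image; apply: eq_bigr => m _; rewrite ffunE; congr (_ * _).
  by apply: eq_bigr => k _; rewrite mxE mnmE.
(* Only nonzero terms are compared: coefficients vanish off the support of [p], and the degree
   bounds put that support inside the box [midx N]. *)
apply: perm_big_supp; apply: uniq_perm; rewrite ?filter_uniq ?msupp_uniq //.
  by rewrite map_inj_uniq ?enum_uniq.
move=> m; rewrite !mem_filter; case: eqP => //= neq0.
have m_p : m \in msupp p.
  by apply: contra_notT neq0 => /memN_msupp_eq0->; rewrite mul0r.
rewrite m_p; apply/esym/imageP.
have lt_m k : (m k < N k)%N.
  by apply: leq_ltn_trans (p_deg k);
    exact: (@leq_bigmax_seq _ _ xpredT (fun m : 'X_{1..d} => m k)).
exists [ffun k => Ordinal (lt_m k)] => //.
by apply/mnmP => k; rewrite mnmE ffunE.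
Qed.

(** * The orthogonal Tucker bound *)

Section Tucker.
Variables (K : numClosedFieldType) (d : nat) (n N : 'I_d -> nat).
Variables (c : tensor K N) (A : forall k, 'M[K]_(n k, N k)).

Lemma p_ML_tucker :
  (p_ML (tucker c A) <= \sum_(k < d) n k * N k + \prod_(k < d) N k)%N.
Proof.
have /fin_all_exists[t /all_and2[le_tN]] k := thin_qr (A k).
move=> /fin_all_exists[B] /fin_all_exists[Q /all_and2[Bu AE]].
rewrite /p_ML; case: ex_minnP => q _ /(_ (ml_storage n t)) le_q.
apply: leq_trans (le_q _) _.
  apply/asboolP; exists t; split=> //.
  (* After substituting [B k *m Q k] for [A k], the matrices [Q k] are absorbed into the core. *)
  exists [ffun j : midx t => \sum_(m : midx N) c m * \prod_k Q k (j k) (m k)], B.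
  split=> // i; rewrite ffunE.
  under [RHS]eq_bigr do rewrite ffunE mulr_suml.
  rewrite exchange_big; apply: eq_bigr => m _ /=.
  under eq_bigr do rewrite AE mxE.
  rewrite prod_sum_midx mulr_sumr; apply: eq_bigr => j _.
  rewrite -mulrA [outer _ _]ffunE -big_split; congr (_ * _).
  by apply: eq_bigr => k _; rewrite mxE mulrC.
rewrite leq_add //; first by apply: leq_sum => k _; rewrite leq_mul2l le_tN orbT.
exact: leq_prod.
Qed.

(** * Restricted multi-indices and the CP bound *)

Hypothesis N_gt0 : forall k, (0 < N k)%N.

(** Exponents outside [P] are set to 0 rather than dropped, so that restrictions to different sets
    of variables share the type [midx N]. *)
Definition trunc (P : pred 'I_d) (m : midx N) : midx N :=
  [ffun k => if P k then m k else Ordinal (N_gt0 k)].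

Definition face (P : pred 'I_d) : {set midx N} := [set m | trunc P m == m].

Lemma trunc_trunc (P Q : pred 'I_d) m :
  subpred P Q -> trunc P (trunc Q m) = trunc P m.
Proof.
move=> sPQ; apply/ffunP => k; rewrite !ffunE.
by case: ifP => // /sPQ ->.
Qed.

Lemma trunc_face P m : trunc P m \in face P.
Proof. by rewrite inE trunc_trunc. Qed.

Lemma truncE (P : pred 'I_d) m k : P k -> trunc P m k = m k.
Proof. by rewrite ffunE => ->. Qed.

Lemma card_face P : #|face P| = (\prod_(k | P k) N k)%N.
Proof.
pose F k : pred 'I_(N k) := if P k then predT else pred1 (Ordinal (N_gt0 k)).
transitivity #|(family F : simpl_pred (midx N))|.
  apply: eq_card => m; rewrite inE; apply/eqP/familyP => [<- k|Fm].
    by rewrite ffunE /F; case: (P k); rewrite // inE.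
  apply/ffunP => k; rewrite ffunE; have := Fm k.
  by rewrite /F; case: (P k) => // /eqP ->.
rewrite card_family foldrE big_image /= [RHS]big_mkcond; apply: eq_bigr => k _.
by rewrite /F; case: ifP => _; rewrite ?card_ord ?card1.
Qed.

Lemma cp_rank_tucker (k0 : 'I_d) :
  cp_rank_le ((\prod_(k < d) N k) %/ N k0) (tucker c A).
Proof.
pose P := predC1 k0.
have -> : ((\prod_(k < d) N k) %/ N k0)%N = #|face P|.
  by rewrite card_face (bigD1 k0) //= mulKn.
(* Terms with the same restriction [u] differ only in the coefficient and in factor [k0]. Summing
   both into that factor leaves all weights equal to 1. *)
pose w k (a : 'I_(n k)) (u : midx N) := if k == k0
  then \sum_(m | trunc P m == u) c m * A k a (m k) else A k a (u k).
exists (fun=> 1), (fun k => \matrix_(a, l) w k a (enum_val l)) => i.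
rewrite ffunE (partition_big (trunc P) (mem (face P)))
    => [|m _]; last exact: trunc_face.
rewrite big_enum_val; apply: eq_bigr => l _; rewrite mul1r [outer _ _]ffunE.
under [RHS]eq_bigr do rewrite !mxE.
rewrite (bigD1 k0) //= {1}/w eqxx mulr_suml; apply: eq_bigr => m /eqP um.
rewrite (bigD1 k0) //= mulrA; congr (_ * _); apply: eq_bigr => k Pk.
by rewrite /w (negPf Pk) -um truncE.
Qed.

Lemma p_CP_tucker (d_gt0 : (0 < d)%N) :
  (p_CP (tucker c A) <= cp_storage n (cp_bound_rank N))%N.
Proof.
have [k0 le_k0] :
    exists k0, ((\prod_(k < d) N k) %/ N k0 <= cp_bound_rank N)%N.
  (* The default value of the minimum dominates every quotient, so any index serves in the base
     case; [0 < d] supplies one. *)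
  apply: (big_rec (fun x => exists k0, ((\prod_(k < d) N k) %/ N k0 <= x)%N))
    => [|k x _ [k0 le_k0]].
    by exists (Ordinal d_gt0); apply: leq_div.
  by case: leqP => _; [exists k | exists k0].
rewrite /p_CP; case: ex_minnP => q _ le_q.
apply: (@leq_trans (cp_storage n ((\prod_(k < d) N k) %/ N k0))).
  apply/le_q/asboolP; exists ((\prod_(k < d) N k) %/ N k0)%N.
  by split=> //; apply: cp_rank_tucker.
by rewrite leq_add // leq_mul2r le_k0 orbT.
Qed.

(** * Tensor-train ranks and cores *)

Lemma tt_bound_rank_crossover (d_gt0 : (0 < d)%N) : exists2 K0 : 'I_d,
    forall k, (k <= K0)%N -> tt_bound_rank N k = (\prod_(j < d | j < k) N j)%N
  & forall k, (K0 < k <= d)%N ->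
      tt_bound_rank N k = (\prod_(j < d | k <= j) N j)%N.
Proof.
pose pre k := (\prod_(j < d | j < k) N j)%N.
pose suf k := (\prod_(j < d | k <= j) N j)%N.
have le_prodS (P Q : pred 'I_d) : subpred P Q ->
    (\prod_(j | P j) N j <= \prod_(j | Q j) N j)%N.
  move=> sPQ; rewrite [leqLHS]big_mkcond [leqRHS]big_mkcond.
  apply: leq_prod => k _; case: ifP => [/sPQ -> // | _].
  by case: ifP => // _; apply: N_gt0.
have pre_homo k l : (k <= l)%N -> (pre k <= pre l)%N.
  by move=> le_kl; apply: le_prodS => j lt_jk; apply: leq_trans le_kl.
have suf_homo k l : (k <= l)%N -> (suf l <= suf k)%N.
  by move=> le_kl; apply: le_prodS => j; apply: leq_trans.
have pre0 : (pre 0%N <= suf 0%N)%N.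
  by rewrite [leqLHS]big_pred0 // prodn_gt0.
(* Prefix products grow and suffix products shrink, so the last index satisfying the inequality
   separates the two regimes; index 0 satisfies it. *)
have [K0 le_K0 maxK0] := @arg_maxnP _ (Ordinal d_gt0)
  (fun k : 'I_d => pre k <= suf k)%N (fun k => val k) pre0.
exists K0 => k.
  move=> le_k; apply/minn_idPl; apply: leq_trans (pre_homo _ _ le_k) _.
  exact: leq_trans le_K0 (suf_homo _ _ le_k).
(* The maximum is over ['I_d], so [k = d] is treated apart: its suffix product is empty. *)
case/andP=> lt_k; rewrite leq_eqVlt => /predU1P[-> | lt_kd].
  apply/minn_idPr; rewrite [leqLHS]big_pred0 ?prodn_gt0 // => j.
  by rewrite leqNgt ltn_ord.
apply/minn_idPr; rewrite leqNgt; apply/negP => /ltnW /(maxK0 (Ordinal lt_kd)).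
by rewrite /= leqNgt lt_k.
Qed.

Section TensorTrain.
Variable K0 : 'I_d.

(** Bond [k] lies to the left of core [k]. At core [K0] the left bond carries the variables before
    [K0] and the right bond those after it. *)
Definition tt_bond (k : nat) : pred 'I_d :=
  fun j : 'I_d => if (k <= K0)%N then (j < k)%N else (k <= j)%N.

Let P := tt_bond.

(** Core entries from state [u] to state [v]. Before [K0] a core appends the exponent of [k] to the
    state, after [K0] it removes it. At [K0] the two states leave only the exponent of [K0] free,
    and it is summed against [c]. *)
Let w (k : 'I_d) (a : 'I_(n k)) (u v : midx N) : K :=
  if (k < K0)%N then (trunc (P k) v == u)%:R * A k a (v k)
  else if k == K0 then
    \sum_(m | (trunc (P k.+1) m == v) && (trunc (P k) m == u)) c m * A k a (m k)
  else (trunc (P k.+1) u == v)%:R * A k a (u k).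

(* The value of the product of the first k cores at column u. *)
Let L (i : midx n) (k : nat) (u : midx N) : K :=
  if (k <= K0)%N then \prod_(j < d | (j < k)%N) A j (i j) (u j)
  else \sum_(m | trunc (P k) m == u)
         c m * \prod_(j < d | (j < k)%N) A j (i j) (m j).

Let prod_ltS (k : 'I_d) (F : 'I_d -> K) :
  \prod_(j < d | (j < k.+1)%N) F j = (\prod_(j < d | (j < k)%N) F j) * F k.
Proof.
rewrite (bigD1 k) //= mulrC; congr (_ * _); apply: eq_bigl => j.
by rewrite ltnS andbC ltn_neqAle.
Qed.

Let L_step i (k : 'I_d) v :
  L i k.+1 v = \sum_(u in face (P k)) L i k u * w (i k) u v.
Proof.
rewrite /w; case: (ltngtP k K0) => [lt_k | lt_k | eq_k].
(* Before [K0] the only contributing row is the restriction of [v]. *)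
- rewrite (bigD1 (trunc (P k) v)) ?trunc_face //= eqxx mul1r.
  rewrite [X in _ + X]big1 ?addr0 => [|u /andP[_ neq_u]]; last first.
    by rewrite eq_sym (negPf neq_u) mul0r mulr0.
  rewrite /L lt_k (ltnW lt_k) prod_ltS; congr (_ * _); apply: eq_bigr => j lt_j.
  by rewrite truncE // /P /tt_bond (ltnW lt_k).
- have neq_k : (k == K0) = false by rewrite -val_eqE gtn_eqF.
  have ltF : (k < K0)%N = false by apply/negbTE; rewrite -leqNgt ltnW.
  have leF : (k <= K0)%N = false by apply/negbTE; rewrite -ltnNge.
  rewrite neq_k /L ltF leF.
  rewrite (partition_big (trunc (P k)) (mem (face (P k))))
    => [|m _]; last exact: trunc_face.
  apply: eq_bigr => u _; rewrite mulr_suml.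
  (* Past [K0] the bonds are nested, so the restriction to bond [k] determines the one to bond
     [k.+1]. *)
  have truncP m : trunc (P k.+1) (trunc (P k) m) = trunc (P k.+1) m.
    rewrite trunc_trunc // => j; rewrite /P /tt_bond ltF leF.
    exact: ltnW.
  have Pk : P k k by rewrite /P /tt_bond leF.
  rewrite [LHS]big_mkcond [RHS]big_mkcond; apply: eq_bigr => m _.
  case: (trunc (P k) m =P u) => [<- | _]; rewrite ?andbF // andbT truncP.
  case: eqP => _; rewrite ?(mul0r, mulr0) // mul1r truncE // prod_ltS.
  by rewrite mulrA.
- have eq_kK : k = K0 by apply: val_inj.
  rewrite eq_kK eqxx /L ltnn leqnn.
  (* The product over [j < K0] depends on [m] only through its restriction [u], hence leaves the
     inner sum. *)
  rewrite (partition_big (trunc (P K0)) (mem (face (P K0))))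
    => [|m _]; last exact: trunc_face.
  apply: eq_bigr => u _; rewrite mulr_sumr; apply: eq_bigr => m /andP[_ /eqP <-].
  rewrite prod_ltS mulrCA; congr (_ * (_ * _)); apply: eq_bigr => j lt_j.
  by rewrite truncE // /P /tt_bond leqnn.
Qed.

Lemma tt_rank_tucker : tt_rank_le (fun k => #|face (tt_bond k)|) (tucker c A).
Proof.
have s0 : #|face (P 0%N)| = 1%N by rewrite card_face big_pred0.
have Pd : P d =1 pred0.
  by move=> j; rewrite /P /tt_bond leqNgt ltn_ord /= leqNgt ltn_ord.
have sd : #|face (P d)| = 1%N by rewrite card_face big_pred0.
pose H (k : 'I_d) (a : 'I_(n k)) :
    'M[K]_(#|face (P k)|, #|face (P k.+1)|) :=
  \matrix_(u, v) w a (enum_val u) (enum_val v).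
exists s0, sd, H => i; rewrite castmxE.
have prodE m (le_md : (m <= d)%N)
    (o : 'I_(#|face (P 0)|)) (v : 'I_(#|face (P m)|)) :
    tt_prod (s := fun k => #|face (P k)|) H i le_md o v = L i m (enum_val v).
  elim: m le_md o v => [|m IHm] le_md o v /=.
    rewrite mxE /L leq0n big_pred0 //.
    suff -> : o = v by rewrite eqxx.
    by apply/(@cast_ord_inj _ _ s0)/ord_inj; rewrite !ord1.
  rewrite mxE (L_step i (Ordinal le_md)).
  rewrite [RHS]big_enum_val; apply: eq_bigr => u _.
  by rewrite IHm mxE.
rewrite prodE /L leqNgt ltn_ord /= ffunE.
(* Bond [d] carries no variable: every [m] restricts to its only state, so the sum in [L] runs over
   all of [midx N]. *)
apply: eq_big => [m | m _]; last by congr (_ * _);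
  apply: eq_bigl => j; rewrite ltn_ord.
apply/esym/eqP; have := enum_valP (cast_ord (esym sd) ord0).
rewrite inE => /eqP <-; apply/ffunP => k.
by rewrite !ffunE Pd.
Qed.

End TensorTrain.

Lemma p_TT_tucker (d_gt0 : (0 < d)%N) :
  (p_TT d_gt0 (tucker c A) <= tt_storage n (tt_bound_rank N))%N.
Proof.
have [K0 lowE highE] := tt_bound_rank_crossover d_gt0.
rewrite /p_TT; case: ex_minnP => q _; apply; apply/asboolP.
exists (fun k => #|face (tt_bond K0 k)|); split; first exact: tt_rank_tucker.
have sE k : (k <= d)%N -> #|face (tt_bond K0 k)| = tt_bound_rank N k.
  move=> le_kd; rewrite card_face /tt_bond.
  by case: leqP => [/lowE -> | lt_k]; rewrite // highE ?lt_k.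
by apply: eq_bigr => k _; rewrite !sE // ltnW.
Qed.

End Tucker.

Theorem lemma3p1 (R : realType) (d : nat) (d_gt0 : (0 < d)%N)
    (N n : 'I_d -> nat) (N_gt0 : forall j, (0 < N j)%N)
    (p : {mpoly R[i][d]})
    (p_deg : forall j : 'I_d, (degvar p j <= N j - 1)%N)
    (x : forall j : 'I_d, 'I_(n j) -> R[i]) :
  let X : tensor R[i] n := sample p x in
  let t := tt_bound_rank N in
  let r := cp_bound_rank N in
  [/\ (p_TT d_gt0 X <= \sum_(k < d) t k * t k.+1 * n k)%N,
      (p_ML X <= \sum_(k < d) n k * N k + \prod_(k < d) N k)%N
    & (p_CP X <= r + r * \sum_(k < d) n k)%N].
Proof.
move=> X t r; have p_deg' j : (degvar p j < N j)%N.
  by rewrite -(subnKC (N_gt0 j)) ltnS p_deg.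
rewrite /X (sample_tucker x p_deg'); split.
- exact: p_TT_tucker.
- exact: p_ML_tucker.
- exact: p_CP_tucker.
Qed.
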